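(* Let $n\ge1$ be an integer and let $k_1,k_2,\dots,k_n$ be non-negative real numbers. Extend the sequence to all integers $r\ge1$ by periodicity, $k_{r+n}=k_r$, and set $\psi(j)=\sum_{\ell=1}^{j}k_\ell$ for integers $j\ge0$, with $\psi(0)=0$. Let $m$ be a real number with $m>\psi(n)$. Let $N$ be the number of indices $j\in\{0,1,\dots,n-1\}$ for which $$\psi(j+r)-\psi(j)<\frac{m}{n}\,r\quad\text{for all } r=1,\dots,n.$$ Then $$N\ge\left\lceil n\left(1-\frac{\psi(n)}{m}\right)\right\rceil .$$
   Context: Here $\lceil x\rceil$ denotes the smallest integer not less than $x$. *)

(* Defs.v *)
From HB Require Import structures.
From mathcomp Require Import all_boot all_order all_algebra.
From mathcomp Require Import reals.

Set Implicit Arguments.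
Unset Strict Implicit.
Unset Printing Implicit Defensive.

Import Order.TTheory GRing.Theory Num.Theory.
Local Open Scope ring_scope.

(* Sequences are indexed from 1: [k 0] is never used, and [psi k 0] is 0. *)
Definition psi (R : realType) (k : nat -> R) (j : nat) : R :=
  \sum_(1 <= l < j.+1) k l.

Definition good_indices (R : realType) (n : nat) (k : nat -> R) (m : R)
    : {set 'I_n} :=
  [set j : 'I_n | [forall r : 'I_n.+1, (0 < r)%N ==>
     (psi k (j + r)%N - psi k j < m / n%:R * r%:R)]].

(* Main.v *)
(* Put f(j) = (m/n) j - psi(j), so that f(j+n) = f(j) + D with D = m - psi(n) > 0,
   and let g(j) be the minimum of f over the window j, ..., j+n.  An index j is
   good exactly when f(j) lies strictly below the rest of its window.  Hence g
   does not increase from j to j+1 when j is bad, and increases by at most m/n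
   when j is good.  Since g(n) - g(0) = D, this gives D <= N m/n. *)

Require Import Defs.
From HB Require Import structures.
From mathcomp Require Import all_boot all_order all_algebra.
From mathcomp Require Import reals lra.

Set Implicit Arguments.
Unset Strict Implicit.
Unset Printing Implicit Defensive.

Import Order.TTheory GRing.Theory Num.Theory.
Local Open Scope ring_scope.

Section WindowMin.

Context {R : realDomainType} (f : nat -> R) (n : nat).

(** The default [f j] is the entry at [r = 0], so it does not alter the minimum. *)
Definition window_min (j : nat) : R :=
  \big[Num.min/f j]_(r < n.+1) f (j + r)%N.

Lemma window_min_le (j r : nat) : (r <= n)%N -> window_min j <= f (j + r)%N.
Proof. by move=> rn; exact: (bigmin_le_cond _ _ (j := Ordinal (rn : (r < n.+1)%N))). Qed.

Lemma le_window_min (j : nat) (x : R) :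
  (forall r, (r <= n)%N -> x <= f (j + r)%N) -> x <= window_min j.
Proof.
move=> xf; apply: le_bigmin => [|r _]; last by apply: xf; rewrite -ltnS.
by have := xf 0%N isT; rewrite addn0.
Qed.

(** Moving the window one step to the right drops only [f j], and the entry [f (j + r)], which stays
    inside, is no larger. *)
Lemma window_minS_le_bad (j r : nat) :
  (0 < r <= n)%N -> f (j + r)%N <= f j -> window_min j.+1 <= window_min j.
Proof.
case: r => [//|r] rn frj; apply: le_window_min => -[|s] sn.
  rewrite addn0; apply: le_trans frj; rewrite -addSnnS.
  by apply: window_min_le; rewrite ltnW.
by rewrite -addSnnS; apply: window_min_le; rewrite ltnW.
Qed.

(** Only the entry [f j] is dropped, and [f j.+1] replaces it at a cost of at most [c]. *)
Lemma window_minS_le (j : nat) (c : R) :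
  0 <= c -> f j.+1 <= f j + c -> window_min j.+1 <= window_min j + c.
Proof.
move=> c0 fS; rewrite -lerBlDr; apply: le_window_min => -[|s] sn; rewrite lerBlDr.
  by rewrite addn0; apply: le_trans fS; rewrite -[X in f X]addn0 window_min_le.
by rewrite -addSnnS ler_wpDr// window_min_le// ltnW.
Qed.

Lemma window_min_shift (p : nat) (D : R) :
  (forall j, f (j + p)%N = f j + D) ->
  forall j, window_min j + D <= window_min (j + p).
Proof.
by move=> fp j; apply: le_window_min => r rn; rewrite addnAC fp lerD2r window_min_le.
Qed.

End WindowMin.

Lemma psiS (R : realType) (k : nat -> R) (j : nat) :
  psi k j.+1 = psi k j + k j.+1.
Proof. by rewrite /psi big_nat_recr. Qed.

Lemma psi_periodic (R : realType) (k : nat -> R) (n : nat) :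
  (forall r, (1 <= r)%N -> k (r + n)%N = k r) ->
  forall j, psi k (j + n) = psi k j + psi k n.
Proof.
move=> kn; elim=> [|j IH]; first by rewrite add0n [psi k 0]big_geq// add0r.
by rewrite addSn !psiS IH -addSn kn// addrAC.
Qed.

Theorem proposition8 (R : realType) (n : nat) (k : nat -> R) (m : R)
    (n_ge1 : (1 <= n)%N)
    (k_ge0 : forall r : nat, (1 <= r <= n)%N -> 0 <= k r)
    (k_periodic : forall r : nat, (1 <= r)%N -> k (r + n)%N = k r)
    (m_gt : psi k n < m) :
  Num.ceil (n%:R * (1 - psi k n / m)) <= (#|good_indices n k m|)%:Z.
Proof.
have m_gt0 : 0 < m.
  by apply: le_lt_trans m_gt; rewrite /psi big_nat_cond; apply: sumr_ge0 => i /andP[/k_ge0].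
have n_gt0 : 0 < n%:R :> R by rewrite ltr0n.
pose c := m / n%:R; have c_gt0 : 0 < c by rewrite divr_gt0.
pose f j := c * j%:R - psi k j; pose g := window_min f n.
have fn j : f (j + n)%N = f j + (m - psi k n).
  rewrite /f psi_periodic// natrD mulrDr [c * n%:R]divfK ?lt0r_neq0//; lra.
have gS (j : 'I_n) : g j.+1 - g j <= if j \in good_indices n k m then c else 0.
  case: ifPn => [_|].
    rewrite lerBlDl; apply: window_minS_le; first exact: ltW.
    (* The increment of [f] at [j] is [c - k j.+1], at most [c] because [k j.+1] is non-negative. *)
    rewrite /f psiS -natr1 mulrDr mulr1; have := k_ge0 j.+1 (ltn_ord j); lra.
  (* A witness [r] of badness satisfies [c * r <= psi k (j + r) - psi k j], that is,
     [f (j + r) <= f j]. *)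
  rewrite inE => /forallPn[r]; rewrite negb_imply -leNgt => /andP[r_gt0 bad].
  rewrite subr_le0; apply: (@window_minS_le_bad _ f n j r).
    by rewrite r_gt0 -ltnS ltn_ord.
  by rewrite /f natrD mulrDr; move: bad; rewrite -/c; lra.
have key : m - psi k n <= c * #|good_indices n k m|%:R.
  have -> : c * #|good_indices n k m|%:R
          = \sum_(j < n) if j \in good_indices n k m then c else 0.
    by rewrite -big_mkcond sumr_const mulr_natr.
  (* Summing [gS] over one period telescopes to [g n - g 0], which the shift by [n] bounds below. *)
  apply: le_trans (ler_sum _ (fun j _ => gS j)).
  rewrite -(big_mkord xpredT (fun j => g j.+1 - g j)) telescope_sumr//.
  by rewrite lerBrDl; have := @window_min_shift _ f n n _ fn 0; rewrite add0n.
rewrite ceil_le_int; apply: le_trans (_ : (m - psi k n) / c <= _).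
  by rewrite /c invf_div mulrCA mulrBl divff ?lt0r_neq0.
by rewrite ler_pdivrMr// mulrC.
Qed.
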